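(* Let $f(k)$ denote the least integer such that every subset $A \subseteq [k]\times[k]$ with $|A| \ge f(k)$ contains a rectangle. If $k$ is an integer with $k \ge 3$, then $$f(k) \ge \frac{1}{16}\left((k+4)\sqrt{4k-3} + 5k + 22\right).$$
   Context: For a positive integer $n$, $[n]=\{1,2,\dots,n\}$. A subset $A\subseteq [k]\times[k]$ contains a rectangle if there are $x,y\in[k]$ and positive integers $d_1,d_2$ such that all four points $(x,y)$, $(x+d_1,y)$, $(x,y+d_2)$, $(x+d_1,y+d_2)$ lie in $A$. *)

(* Defs.v *)
From mathcomp Require Import all_boot all_order all_algebra.

Set Implicit Arguments.
Unset Strict Implicit.
Unset Printing Implicit Defensive.

(* The grid [k] x [k] is 'I_k * 'I_k; the shift from {1, ..., k} to
   {0, ..., k-1} is harmless, rectangles being translation invariant. *)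
(* In the boolean test, (x', y') = (x + d1, y + d2) is the corner opposite to
   (x, y); contains_rectangleP gives the form with explicit d1, d2. *)
Definition contains_rectangle k (A : {set 'I_k * 'I_k}) : bool :=
  [exists x : 'I_k, exists y : 'I_k, exists x' : 'I_k, exists y' : 'I_k,
    [&& x < x', y < y',
        (x, y) \in A, (x', y) \in A, (x, y') \in A & (x', y') \in A]].

Lemma contains_rectangleP k (A : {set 'I_k * 'I_k}) :
  let pt a b := exists2 p, p \in A & (p.1 = a :> nat) /\ (p.2 = b :> nat) in
  reflect
    (exists x y d1 d2 : nat, 0 < d1 /\ 0 < d2 /\
       [/\ pt x y, pt (x + d1) y, pt x (y + d2) & pt (x + d1) (y + d2)])
    (contains_rectangle A).
Proof.
move=> pt; apply: (iffP existsP).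
  move=> [x /existsP[y /existsP[x' /existsP[y' /and5P[xx' yy' Axy Ax'y]]]]].
  move=> /andP[Axy' Ax'y'].
  exists x, y, (x' - x), (y' - y); rewrite !subn_gt0 !subnKC ?(ltnW xx', ltnW yy') //.
  split=> //; split=> //.
  by split; [exists (x, y) | exists (x', y) | exists (x, y') | exists (x', y')].
move=> [x [y [d1 [d2 [d1_gt0 [d2_gt0 []]]]]]].
move=> [[x1 y1] A1 /= [ex1 ey1]] [[x2 y2] A2 /= [ex2 ey2]].
move=> [[x3 y3] A3 /= [ex3 ey3]] [[x4 y4] A4 /= [ex4 ey4]].
have E2 : y2 = y1 by apply: val_inj; rewrite /= ey2.
have E3 : x3 = x1 by apply: val_inj; rewrite /= ex3.
have E4 : x4 = x2 by apply: val_inj; rewrite /= ex4.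
have E4' : y4 = y3 by apply: val_inj; rewrite /= ey4.
subst y2 x3 x4 y4.
exists x1; apply/existsP; exists y1; apply/existsP; exists x2.
apply/existsP; exists y3; rewrite A1 A2 A3 A4 ex1 ey1 ex2 ey3 !andbT.
by rewrite -{1}[x]addn0 -{1}[y]addn0 !ltn_add2l d1_gt0.
Qed.

Definition forces_rectangle k (m : nat) : bool :=
  [forall A : {set 'I_k * 'I_k}, (m <= #|A|) ==> contains_rectangle A].

Lemma forces_rectangle_ex k : exists m, forces_rectangle k m.
Proof.
exists #|{: 'I_k * 'I_k}|.+1; apply/forallP => A; apply/implyP => leA.
by have := leq_ltn_trans (max_card (mem A)) leA; rewrite ltnn.
Qed.

(* The least integer is sought in nat: no m <= 0 forces a rectangle, because
   of the empty set. *)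
Definition rectangle_number k : nat := ex_minn (forces_rectangle_ex k).

(* Main.v *)
(* The incidence relation of the projective plane of order q is a
   rectangle-free set of (q + 1)(q^2 + q + 1) cells, since two points lie on
   one common line. Take for q the power of 2 with
   q^2 + q + 1 <= k < (2q)^2 + 2q + 1. The claimed bound is increasing in k,
   and at k = (2q)^2 + 2q + 1, where sqrt(4k - 3) = 4q + 1, it equals
   (q + 1)(q^2 + q + 1) + 1. For q = 1 there is no field and the triangle
   replaces the plane. *)
Require Import Defs.
From mathcomp Require Import all_boot all_order all_algebra.
From mathcomp Require Import finfield ring lra zify.
Import Order.TTheory GRing.Theory Num.Theory.
Local Open Scope ring_scope.

(** No order on [T] is involved, so the notion fits points and lines of a plane directly. *)
Definition rectangle_free (T : finType) (S : {set T * T}) : Prop :=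
  forall x x' y y', (x, y) \in S -> (x', y) \in S ->
    (x, y') \in S -> (x', y') \in S -> x = x' \/ y = y'.

(** Enumerating [T] embeds [S] in the grid without creating a rectangle, so no [m <= #|S|] forces
    one. *)
Lemma rectangle_free_card_lt (T : finType) (S : {set T * T}) (k : nat) :
  (#|T| <= k)%N -> rectangle_free T S -> (#|S| < rectangle_number k)%N.
Proof.
move=> leTk freeS; rewrite /rectangle_number; case: ex_minnP => m force_m _ /=.
rewrite ltnNge; apply/negP => le_mS.
pose f (x : T) := widen_ord leTk (enum_rank x).
have f_inj : injective f by move=> x y /(congr1 val) /= /val_inj/enum_rank_inj.
pose g (p : T * T) := (f p.1, f p.2).
have g_inj : injective g. 
  by move=> [a b] [c d] e; rewrite (f_inj a c (congr1 fst e)) (f_inj b d (congr1 snd e)).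
have mem_g a b : (f a, f b) \in g @: S -> (a, b) \in S.
  by rewrite -[(f a, f b)]/(g (a, b)) mem_imset.
have /forallP/(_ (g @: S)) := force_m; rewrite card_imset // le_mS /=.
apply/negP/existsP => -[u /existsP[v /existsP[u' /existsP[v']]]].
case/and5P=> lt_u lt_v uvS u'vS /andP[uv'S u'v'S].
case/imsetP: (uvS) => -[x y] _ [eu ev]; case/imsetP: (u'v'S) => -[x' y'] _ [eu' ev'].
subst u v u' v'.
have [e|e] := freeS x x' y y' (mem_g _ _ uvS) (mem_g _ _ u'vS) (mem_g _ _ uv'S) (mem_g _ _ u'v'S).
- by rewrite e ltnn in lt_u.
- by rewrite e ltnn in lt_v.
Qed.

Lemma triangle_rectangle_free :
  rectangle_free 'I_3 [set p | p.1 != p.2].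
Proof.
move=> x x' y y'; rewrite !inE /= -!val_eqE /= => h1 h2 h3 h4.
suff: (x == x' :> nat) || (y == y' :> nat).
  by case/orP=> /eqP/val_inj; [left | right].
by move: (ltn_ord x) (ltn_ord x') (ltn_ord y) (ltn_ord y'); lia.
Qed.

Lemma card_triangle : #|[set p : 'I_3 * 'I_3 | p.1 != p.2]| = 6.
Proof.
have -> : [set p : 'I_3 * 'I_3 | p.1 != p.2] = ~: [set (x, x) | x in 'I_3].
  apply/setP => -[x y]; rewrite !inE /=; congr (~~ _).
  by apply/eqP/imsetP => [->|[z _ [-> ->]]] //; exists y.
by rewrite cardsCs setCK card_imset ?card_prod ?card_ord // => x y [].
Qed.

Section ProjectivePlane.
Variable F : finFieldType.

(* Points and lines share this encoding. As a point: inr (x, y) is affine,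
   inl m is the direction of slope m, None the vertical direction. As a line:
   inr (m, b) is y = m * x + b, inl a is x = a, None the line at infinity. *)
Definition plane : finType := option (F + F * F).

Definition incident (p l : plane) : bool :=
  match p, l with
  | Some (inr (x, y)), Some (inr (m, b)) => y == m * x + b
  | Some (inr (x, _)), Some (inl a) => x == a
  | Some (inl m'), Some (inr (m, _)) => m' == m
  | Some (inl _), None | None, Some (inl _) | None, None => true
  | _, _ => false
  end.

(* The second argument parametrizes the pencil of lines through p. *)
Definition line_through (p : plane) (d : option F) : plane :=
  match p, d with
  | Some (inr (x, y)), Some m => Some (inr (m, y - m * x))
  | Some (inr (x, _)), None => Some (inl x)
  | Some (inl m), Some b => Some (inr (m, b))
  | None, Some a => Some (inl a)
  | _, None => None
  end.

Lemma line_through_inj p : injective (line_through p).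
Proof. by case: p => [[m|[x y]]|] [a|] [b|] //= [->]. Qed.

Lemma incident_line_through p d : incident p (line_through p d).
Proof. by case: p d => [[m|[x y]]|] [a|] //=; rewrite ?eqxx // addrC subrK. Qed.

Lemma card_plane : #|plane| = (#|F| ^ 2 + #|F| + 1)%N.
Proof. by rewrite card_option card_sum card_prod mulnn addn1 addnC. Qed.

Lemma incident_rectangle_free :
  rectangle_free plane [set p | incident p.1 p.2].
Proof.
move=> [[m|[x y]]|] [[m'|[x' y']]|] [[a|[n b]]|] [[a'|[n' b']]|];
  rewrite !inE //= => h1 h2 h3 h4;
  repeat match goal with H : is_true (_ == _) |- _ => move/eqP in H end;
  try by subst; auto.
(* What remains has two non-vertical affine lines: first a direction and an affine point, in either
   order, then two affine points. *)
- by right; move: h4; rewrite h2 -h1 h3 => /addrI ->.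
- by right; move: h3; rewrite h1 -h2 h4 => /addrI ->.
(* Either the lines are parallel with a common point, hence equal, or the points share an abscissa
   on a non-vertical line, hence coincide. *)
- have /eqP: (n - n') * (x - x') = 0.
    have -> : (n - n') * (x - x') =
      (n * x + b) - (n * x' + b) - ((n' * x + b') - (n' * x' + b')) by ring.
    by rewrite -h1 -h2 -h3 -h4 subrr.
  rewrite mulf_eq0 !subr_eq0 => /orP[] /eqP e.
    by right; move: h3; rewrite h1 e => /addrI ->.
  by left; rewrite h1 h2 e.
Qed.

(** Each point is paired with the [#|F| + 1] distinct lines of its pencil. *)
Lemma card_incident_ge :
  ((#|F| ^ 2 + #|F| + 1) * (#|F| + 1) <= #|[set p | incident p.1 p.2]|)%N.
Proof.
pose flag (pd : plane * option F) := (pd.1, line_through pd.1 pd.2).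
have flag_inj : injective flag.
  by move=> [p d] [p' d'] /= [<- /line_through_inj ->].
rewrite -card_plane addn1 -card_option -card_prod -(card_imset _ flag_inj).
apply/subset_leq_card/subsetP => _ /imsetP[[p d] _ ->].
by rewrite inE incident_line_through.
Qed.

End ProjectivePlane.

Lemma pow2_plane_size (k : nat) : (3 <= k)%N ->
  exists n, ((2 ^ n) ^ 2 + 2 ^ n + 1 <= k < (2 ^ n.+1) ^ 2 + 2 ^ n.+1 + 1)%N.
Proof.
move=> k_ge3.
have: exists n, (k < (2 ^ n) ^ 2 + 2 ^ n + 1)%N.
  exists k; have := ltn_expl k (isT : 1 < 2)%N; lia.
(* Exponent 0 would give k < 3; otherwise the predecessor of the least exponent is the [n]
   sought. *)
case/ex_minnP=> -[|n] lt_k min_n; first by move: lt_k k_ge3; rewrite expn0; lia.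
exists n; rewrite lt_k andbT leqNgt; apply/negP => /min_n; rewrite ltnn //.
Qed.

Lemma rectangle_number_gt (n k : nat) : ((2 ^ n) ^ 2 + 2 ^ n + 1 <= k)%N ->
  (((2 ^ n) ^ 2 + 2 ^ n + 1) * (2 ^ n + 1) < rectangle_number k)%N.
Proof.
case: n => [|n] le_k.
  (* For q = 1 the product computes to 3 * 2 = 6, the size of the triangle. *)
  rewrite expn0 -[X in (X < _)%N]card_triangle.
  by apply: rectangle_free_card_lt triangle_rectangle_free; rewrite card_ord.
have [F _ cardF] := pPrimePowerField (isT : prime 2) (ltn0Sn n).
rewrite -cardF in le_k *; apply: leq_ltn_trans (card_incident_ge F) _.
by apply: rectangle_free_card_lt (incident_rectangle_free F); rewrite card_plane.
Qed.

Theorem theorem5 (R : rcfType) (k : nat) (hk : (3 <= k)%N) :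
  16^-1 * ((k%:R + 4) * Num.sqrt (4 * k%:R - 3) + 5 * k%:R + 22)
    <= (rectangle_number k)%:R :> R.
Proof.
have [n /andP[le_k lt_k]] := pow2_plane_size k hk.
have gt_f := rectangle_number_gt n k le_k.
move: lt_k gt_f; rewrite (expnS 2 n) expnMn; move: (2 ^ n)%N => q lt_k gt_f.
apply: (@le_trans _ _ ((q ^ 2 + q + 1) * (q + 1) + 1)%N%:R); last first.
  by rewrite ler_nat addn1.
have : k%:R <= (4 * q ^ 2 + 2 * q + 1)%N%:R :> R by rewrite ler_nat; lia.
have : 0 <= k%:R :> R := ler0n _ _.
have : 0 <= q%:R :> R := ler0n _ _.
rewrite !(natrD, natrM, natrX).
move: (q%:R : R) (k%:R : R) => x y x_ge0 y_ge0 le_y.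
(* By [le_y], 4y - 3 <= 16x^2 + 8x + 1 = (4x + 1)^2. *)
have le_s : Num.sqrt (4 * y - 3) <= 4 * x + 1.
  have /ger0_norm <- : 0 <= 4 * x + 1 by lra.
  by rewrite -sqrtr_sqr; apply: ler_wsqrtr; lra.
have : (y + 4) * Num.sqrt (4 * y - 3) <= (y + 4) * (4 * x + 1).
  by apply: ler_wpM2l le_s; lra.
(* It suffices that (4x + 6)y + 16x + 26 <= 16(x^3 + 2x^2 + 2x + 2), which is [le_y] multiplied by
   4x + 6. *)
nra.
Qed.
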